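(* Let $X$ be a second-countable topological vector space and let $Y$ be a topological space. Then every conically quasi-continuous function $f:X\to Y$ is $F_\sigma$-measurable.
   Context: All topological vector spaces are over $\mathbb R$ and are assumed to be Hausdorff. A subset $U$ of a topological vector space $X$ is $x$-conical (conical at a point $x\in X$) if $U\neq\emptyset$ and for every $u\in U$ the open segment $(x;u)=\{(1-t)x+tu:0<t<1\}$ is contained in $U$. A function $f:X\to Y$ from a topological vector space $X$ to a topological space $Y$ is conically quasi-continuous if for any point $x\in X$, any $x$-conical open set $V\subset X$ and any open neighborhood $W\subset Y$ of $f(x)$ there exists an $x$-conical open set $U\subset V$ such that $f(U)\subset W$. A subset $U$ of a topological space $Y$ is functionally open if $U=g^{-1}(V)$ for some continuous $g:Y\to\mathbb R$ and some open $V\subseteq\mathbb R$. A function $f:X\to Y$ between topological spaces is $F_\sigma$-measurable if for every functionally open $U\subset Y$ the preimage $f^{-1}(U)$ is of type $F_\sigma$ in $X$ (a countable union of closed sets). *)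

(* Defs.v *)
From mathcomp Require Import all_boot all_order all_algebra.
From mathcomp Require Import all_classical all_reals all_analysis.
From mathcomp Require Import borel_hierarchy.
Import GRing.Theory numFieldNormedType.Exports.

Set Implicit Arguments.
Unset Strict Implicit.
Unset Printing Implicit Defensive.

Local Open Scope classical_set_scope.
Local Open Scope ring_scope.

Definition open_segment (R : realType) (X : lmodType R) (x u : X) : set X :=
  [set (1 - t) *: x + t *: u | t in [set t : R | 0 < t < 1]].

Definition conical (R : realType) (X : lmodType R) (x : X) (U : set X) : Prop :=
  U !=set0 /\ forall u, U u -> open_segment x u `<=` U.

(* Topological vector spaces are of type topologicalLmodType here, because
   tvsType additionally requires local convexity. *)
Definition conically_quasi_continuous (R : realType)
    (X : topologicalLmodType R) (Y : topologicalType) (f : X -> Y) : Prop :=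
  forall (x : X) (V : set X) (W : set Y),
    open V -> conical x V -> open_nbhs (f x) W ->
    exists U : set X, [/\ open U, conical x U, U `<=` V & f @` U `<=` W].

Definition functionally_open (R : realType) (Y : topologicalType)
    (U : set Y) : Prop :=
  exists (g : Y -> R) (V : set R), [/\ continuous g, open V & U = g @^-1` V].
Arguments functionally_open R {Y} U.

(* R only serves as the codomain in functionally_open and cannot be inferred
   from f. *)
Definition Fsigma_measurable (R : realType) (X Y : topologicalType)
    (f : X -> Y) : Prop :=
  forall U : set Y, functionally_open R U -> Fsigma (f @^-1` U).
Arguments Fsigma_measurable R {X Y} f.

(* Main.v *)
Require Import Defs.
From mathcomp Require Import all_boot all_order all_algebra.
From mathcomp Require Import all_classical all_reals all_analysis.
From mathcomp Require Import borel_hierarchy lra.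
Import Order.TTheory GRing.Theory Num.Theory numFieldNormedType.Exports.

(** Let [U = g @^-1` V] be functionally open.  The open set [V] is a countable
    union of open sets, each disjoint from an open set that contains the
    complement of [V] ([open_exhaustion]).  Pulling these back along [g] gives
    disjoint open sets [W] and [O] of [Y] with [~` U] inside [O], and such
    sets [W] cover [U].  It is then enough to find, for each such pair, an
    F_sigma set that contains [f @^-1` W] and is disjoint from [f @^-1` O].

    For an open set [B], let [seers B S] be the set of points [x] all of whose
    open segments towards points of [B] lie in [S].  It is closed for an
    arbitrary set [S] ([closed_seers]), hence the union of the sets
    [seers B (f @^-1` W)] over the nonempty members [B] of a countable basis
    is an F_sigma set.  It separates the two preimages because
    - if [f x] is in [W], conical quasi-continuity gives an open [x]-conical
      set inside [f @^-1` W]; it contains a basic set [B], and then [x] is in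
      [seers B (f @^-1` W)];
    - if [x] is in [seers B (f @^-1` W)], the segments from [x] to [B] form an
      open [x]-conical set inside [f @^-1` W].  If [f x] were in [O], conical
      quasi-continuity would give a nonempty subset of this cone inside
      [f @^-1` O], although [W] and [O] are disjoint. *)

Set Implicit Arguments.
Unset Strict Implicit.
Unset Printing Implicit Defensive.

Local Open Scope classical_set_scope.
Local Open Scope ring_scope.

Section Seers.
Context {R : realType} {X : topologicalLmodType R}.
Implicit Types (B S : set X) (x u p : X).

Definition seers B S : set X :=
  [set x | forall u, B u -> open_segment x u `<=` S].

Definition cone x B : set X := \bigcup_(u in B) open_segment x u.

Lemma affine_continuous (a : R) (b : X) : continuous (fun y : X => b + a *: y).
Proof.
move=> x; apply: (@continuous_comp X (X * X)%type X (fun y => (b, a *: y))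
  (fun z : X * X => z.1 + z.2)); last exact: add_continuous.
apply: cvg_pair; first exact: cvg_cst.
apply: (@continuous_comp X (R^o * X)%type X (fun y => (a, y))
  (fun z : R^o * X => z.1 *: z.2)); last exact: scale_continuous.
by apply: (@cvg_pair _ _ _ _ (nbhs (a : R^o))); [exact: cvg_cst|exact: cvg_id].
Qed.

(** A point [p] outside [S] on the segment from [x] to [u] also witnesses that
    the points [y] near [x] fail: with [p] and [t] fixed, the endpoint of the
    segment depends continuously on its origin, so it stays in [B]. *)
Lemma closed_seers B S : open B -> closed (seers B S).
Proof.
move=> oB; rewrite -openC openE => x /= /existsNP[u].
move=> /not_implyP[Bu] /existsNP[p] /not_implyP[[t /= t01 <-]] nSp.
have t0 : t != 0 by case/andP: t01 => /gt_eqF ->.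
pose p0 := (1 - t) *: x + t *: u.
pose aim (y : X) : X := t^-1 *: p0 + (- (t^-1 * (1 - t))) *: y.
have aimx : aim x = u.
  by rewrite /aim scalerDr !scalerA mulVf// scale1r addrAC scaleNr subrr add0r.
have nearB : \forall y \near x, B (aim y).
  apply: (@affine_continuous (- (t^-1 * (1 - t))) (t^-1 *: p0) x).
  by rewrite -/(aim x) aimx; exact: open_nbhs_nbhs.
rewrite /interior; apply: filterS nearB => y /= Bay /(_ _ Bay) /(_ p0) Sp0.
apply/nSp/Sp0.
exists t => //; rewrite /aim scalerDr !scalerA mulrN !mulrA divff//.
by rewrite !mul1r scale1r scaleNr addrC subrK.
Qed.

(** With [x] and [t] fixed, the endpoint of the segment depends continuously on
    its point of parameter [t]. *)
Lemma open_cone x B : open B -> open (cone x B).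
Proof.
move=> oB; rewrite openE => p [u Bu [t /= t01 <-]].
have t0 : t != 0 by case/andP: t01 => /gt_eqF ->.
pose aim (q : X) : X := - (t^-1 *: ((1 - t) *: x)) + t^-1 *: q.
have aimp : aim ((1 - t) *: x + t *: u) = u.
  by rewrite /aim scalerDr addKr scalerA mulVf// scale1r.
have nearB : \forall q \near (1 - t) *: x + t *: u, B (aim q).
  apply: (@affine_continuous t^-1 (- (t^-1 *: ((1 - t) *: x)))).
  by rewrite -/(aim _) aimp; exact: open_nbhs_nbhs.
rewrite /interior; apply: filterS nearB => q /= Bq.
exists (aim q) => //; exists t => //.
by rewrite /aim scalerDr scalerN !scalerA divff// mul1r scale1r addNKr.
Qed.

Lemma conical_cone x B : B !=set0 -> conical x (cone x B).
Proof.
move=> [u Bu]; split.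
  exists ((1 - 2^-1) *: x + 2^-1 *: u); exists u => //; exists 2^-1 => //=.
  lra.
move=> _ [v Bv [t /= /andP[t0 t1] <-]] _ [s /= /andP[s0 s1] <-].
exists v => //; exists (s * t) => /=.
  by rewrite mulr_gt0//= mulr_ilt1 // ltW.
rewrite scalerDr !scalerA addrA -scalerDl; congr (_ *: _ + _).
by rewrite mulrBr mulr1 addrA subrK.
Qed.

End Seers.

(** Along an injection of [D] into [nat], each stage is the union of at most one
    of the sets [F i], so it stays closed. *)
Lemma Fsigma_bigcup (T : topologicalType) (I : Type) (D : set I)
    (F : I -> set T) : countable D -> (forall i, D i -> closed (F i)) ->
  Fsigma (\bigcup_(i in D) F i).
Proof.
move=> /countable_injP[e inje] cF.
exists (fun n => \bigcup_(i in [set i | D i /\ e i = n]) F i).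
  move=> n; have [[i [Di ein]]|] := pselect (exists i, D i /\ e i = n).
    rewrite (_ : [set _ | _] = [set i]); first by rewrite bigcup_set1; exact: cF.
    apply/seteqP; split=> [j [Dj ejn]|_ ->//].
    by apply: inje; rewrite ?inE// ein ejn.
  move=> none; rewrite (_ : [set _ | _] = set0).
    by rewrite bigcup_set0; exact: closed0.
  by apply/seteqP; split=> // i Hi; apply: none; exists i.
apply/seteqP; split=> [x [i Di Fx]|x [n _ [i [Di _] Fx]]]; last by exists i.
by exists (e i) => //; exists i.
Qed.

(** For [O k], take the points at distance less than [1 / (k + 1)] from the
    complement of [V], and for [W k] its exterior.  The interiors in the code
    are there because a ball of a pseudometric structure may fail to be open. *)
Lemma open_exhaustion (R : realType) (T : pseudoMetricType R) (V : set T) :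
  open V ->
  exists W O : nat -> set T,
    [/\ forall k, open (W k) /\ open (O k), forall k, W k `&` O k = set0,
        forall k, ~` V `<=` O k & V `<=` \bigcup_k W k].
Proof.
move=> oV.
pose O k : set T := \bigcup_(s in ~` V) (ball s k.+1%:R^-1)°.
have subO k : ~` V `<=` O k.
  by move=> s nVs; exists s => //; apply: nbhs_singleton; apply: nbhs_interior;
    exact: nbhsx_ballx.
exists (fun k => (~` O k)°), O; split => //.
- by move=> k; split; [exact: open_interior|apply: bigcup_open => s _;
    exact: open_interior].
- by move=> k; apply/seteqP; split=> // s [/interior_subset].
move=> r Vr; have /nbhs_ballP[e /= e0 eV] := open_nbhs_nbhs (conj oV Vr).
have e20 : 0 < e / 2 by rewrite divr_gt0.
have [k _ ke] : \forall k \near \oo, k.+1%:R^-1 < e / 2.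
  exact: near_infty_natSinv_lt (PosNum e20).
exists k => //; apply/nbhs_ballP; exists (e / 2) => //= q rq [s nVs].
(* A point within e / 2 of both r and s would put s in the ball around r. *)
move=> /interior_subset sq; apply/nVs/eV.
rewrite [e]splitr; apply: (ball_triangle rq); apply: ball_sym.
by apply: le_ball sq; exact/ltW/ke/leqnn.
Qed.

Section Separation.
Context {R : realType} {X : topologicalLmodType R} {Y : topologicalType}.
Variables (f : X -> Y) (qcf : conically_quasi_continuous f).

(** The quasi-continuity is used here with the whole space as ambient cone. *)
Lemma preimage_sub_seers (Bs : set (set X)) (W : set Y) : basis Bs -> open W ->
  f @^-1` W `<=` \bigcup_(B in Bs `&` [set B | B !=set0]) seers B (f @^-1` W).
Proof.
move=> [_ baseBs] oW x Wfx.
have conT : conical x [set: X] by split=> //; exists x.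
have [U [oU [[u Uu] conU] _ fUW]] := qcf openT conT (conj oW Wfx).
have [B [BsB Bu] BU] := baseBs u _ (open_nbhs_nbhs (conj oU Uu)).
exists B; first by split=> //; exists u.
by move=> v /BU /conU segU p /segU Up; apply: fUW; exists p.
Qed.

(** The quasi-continuity is used here with [cone x B] as ambient cone, to move
    from [x] to a point of the cone with its value in [O]. *)
Lemma seers_sub_preimageC (B : set X) (W O : set Y) :
  open B -> B !=set0 -> open O -> W `&` O = set0 ->
  seers B (f @^-1` W) `<=` ~` (f @^-1` O).
Proof.
move=> oB B0 oO WO x seex Ofx.
have [U [_ [[u Uu] _] Ucone fUO]] :=
  qcf (open_cone x oB) (conical_cone x B0) (conj oO Ofx).
have [v Bv xvu] := Ucone u Uu.
have : (W `&` O) (f u) by split; [exact: (seex v)|apply: fUO; exists u].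
by rewrite WO.
Qed.

End Separation.

Theorem theorem1p4 (R : realType) (X : topologicalLmodType R)
    (Y : topologicalType) (hausdorffX : hausdorff_space X)
    (countableX : @second_countable X) (f : X -> Y)
    (qcf : conically_quasi_continuous f) :
  Fsigma_measurable R f.
Proof.
move=> _ [g [V [cg oV ->]]].
have [W [ O [oWO WO0 VO VW]]] := open_exhaustion oV.
have og (A : set R) : open A -> open (g @^-1` A).
  by move=> oA; apply: open_comp => // y _; exact: cg.
have [Bs cBs baseBs] := countableX; have [Bs_open _] := baseBs.
pose D := [set: nat] `*` (Bs `&` [set B | B !=set0]).
have cD : countable D.
  apply: cardinality.countableX (countableP _) (sub_countable _ cBs).
  by apply: subset_card_le => ? [].
rewrite (_ : f @^-1` _ =
  \bigcup_(i in D) seers i.2 (f @^-1` (g @^-1` W i.1))).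
  apply: Fsigma_bigcup cD _ => -[k B] [_ [/= BsB _]].
  exact: closed_seers (Bs_open _ BsB).
apply/seteqP; split=> [x /VW[k _ Wk]|x [[k B] [_ [/= BsB B0]] seex]].
  have [B DB xB] := preimage_sub_seers qcf baseBs (og _ (oWO k).1) Wk.
  by exists (k, B).
apply: contrapT => nVx.
have WO0Y : g @^-1` W k `&` g @^-1` O k = set0.
  by rewrite -preimage_setI WO0 preimage_set0.
apply: (seers_sub_preimageC qcf (Bs_open _ BsB) B0 _ WO0Y seex).
  exact/og/(oWO k).2.
exact: VO.
Qed.
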